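(* Let $\mathcal C_e$ be a D-component, $S\in\mathcal C_e$ and $Q\in\mathrm{SO}_n$. If the nearby logarithm $\mathrm{nlog}_S(Q)$ of $Q$ around $S$ exists, i.e. $\mathrm{nlog}_S(Q)\in\mathcal C_e\cap\{X:\|X-S\|_2<\pi\}\cap\exp^{-1}(Q)$, then it is the unique solution of $$\underset{X\in\exp^{-1}(Q)}{\arg\min}\ \|X-S\|_F .$$
   Context: $\mathrm{Skew}_n$: real $n\times n$ skew-symmetric matrices; $\mathrm{SO}_n$: special orthogonal group; $\exp^{-1}(Q)=\{X\in\mathrm{Skew}_n:\exp(X)=Q\}$. $\mathfrak S$ is the set of $X\in\mathrm{Skew}_n$ at which the differential of $\exp:\mathrm{Skew}_n\to\mathrm{SO}_n$ is rank-deficient. A D-component is a maximal path-connected subset of $\mathrm{Skew}_n\setminus\mathfrak S$; two matrices are D-connected if they lie in the same D-component. For $S\in\mathrm{Skew}_n\setminus\mathfrak S$ let $\mathcal N_S=\{X\in\mathrm{Skew}_n\setminus\mathfrak S: X\text{ and }S\text{ are D-connected and }\|X-S\|_2<\pi\}$; the map $\exp:\mathcal N_S\to\mathcal Z_S:=\exp(\mathcal N_S)$ is a diffeomorphism (known), and its inverse $\mathrm{nlog}_S:\mathcal Z_S\to\mathcal N_S$ is the nearby logarithm around $S$. $\|\cdot\|_2$ is the spectral norm and $\|\cdot\|_F$ the Frobenius norm. *)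

(* Defs.v *)
From HB Require Import structures.
From mathcomp Require Import all_boot all_order all_algebra.
From mathcomp Require Import all_classical all_reals all_analysis.

Set Implicit Arguments.
Unset Strict Implicit.
Unset Printing Implicit Defensive.

Import Order.TTheory GRing.Theory Num.Theory.
Import numFieldNormedType.Exports.

Local Open Scope classical_set_scope.
Local Open Scope ring_scope.

Section Matrices.
Variables (R : realType) (n : nat).
Implicit Types (X Y S Q : 'M[R]_n) (C : set 'M[R]_n).

Definition Skew : set 'M[R]_n := [set X | X^T = - X].

Definition SO : set 'M[R]_n := [set Q | Q^T *m Q = 1%:M /\ \det Q = 1].

(* The limit is taken in the normed space 'M[R]_n, where the series always
   converges. *)
Definition expm X : 'M[R]_n :=
  limn (series (fun k => (k`!%:R)^-1 *: X ^+ k)).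

Definition expm_preim Q : set 'M[R]_n := [set X | Skew X /\ expm X = Q].

(* On column vectors this is the Euclidean norm. *)
Definition frobnorm (p q : nat) (A : 'M[R]_(p, q)) : R :=
  Num.sqrt (\sum_i \sum_j A i j ^+ 2).

(* The operator norm subordinate to the Euclidean norm; using the closed unit
   ball rather than the sphere gives the right value when n = 0. *)
Definition specnorm X : R :=
  sup [set frobnorm (X *m v) | v in [set v : 'cV[R]_n | frobnorm v <= 1]].

(* Skew as a subspace, so that ranks of linear maps on it make sense. *)
Definition skewv : {vspace 'M[R]_n} := lker (linfun trmx + \1)%VF.

Lemma skewvP X : X \in skewv <-> Skew X.
Proof.
rewrite memv_ker add_lfunE id_lfunE lfunE /= addr_eq0.
by split=> [/eqP|/= ->].
Qed.

(* The differential at X of exp : Skew -> SO is the restriction to the linear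
   subspace Skew of the differential of expm on 'M[R]_n, and dim SO = dim Skew;
   so it is rank-deficient when the image of Skew has a smaller dimension. *)
Definition rank_deficient : set 'M[R]_n :=
  [set X | Skew X /\ (\dim (linfun ('d expm X) @: skewv) < \dim skewv)%N].

Definition path_connected C : Prop :=
  forall X Y, C X -> C Y ->
    exists g : R -> 'M[R]_n,
      [/\ {within `[0, 1], continuous g}, g 0 = X, g 1 = Y &
          forall t, t \in `[0, 1] -> C (g t)].

Definition Dcomponent C : Prop :=
  [/\ C `<=` Skew `\` rank_deficient, path_connected C &
      forall C', C' `<=` Skew `\` rank_deficient -> path_connected C' ->
        C `<=` C' -> C' = C].

Definition Dconnected X Y : Prop :=
  exists C, [/\ Dcomponent C, C X & C Y].

Definition nearby S : set 'M[R]_n :=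
  [set X | [/\ (Skew `\` rank_deficient) X, Dconnected X S &
               specnorm (X - S) < pi]].

(* The inverse of expm : nearby S -> expm @` nearby S, extended by 0 outside
   expm @` nearby S. *)
Definition nlog S : 'M[R]_n -> 'M[R]_n := 'pinv_(fun=> 0) (nearby S) expm.

End Matrices.

Definition argmin (T : Type) (R : realType) (A : set T) (f : T -> R) : set T :=
  [set x | A x /\ forall y, A y -> f x <= f y].

(* Main.v *)
(* Write L for nlog S Q.  If Y is another skew logarithm of Q, then Y commutes
   with Q = expm Y, and the differential of the exponential at L maps the
   skew matrix [Y, L] to [Y, expm L] = 0; since L is not rank-deficient, Y and L
   commute.  Hence D := Y - L satisfies expm D = 1, so that every nonzero
   eigenvalue of D^T D is at least (2 pi)^2.  With E := L - S of spectral norm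
   less than pi, every eigenvector w of D^T D with D w != 0 satisfies
   |(D + E) w|^2 >= |D w|^2 / 2 - |E w|^2 >= 2 pi^2 |w|^2 - |E w|^2 > |E w|^2,
   and summing over an eigenbasis gives |Y - S|_F > |L - S|_F. *)
Require Import Defs.
From HB Require Import structures.
From mathcomp Require Import all_boot all_order all_algebra.
From mathcomp Require Import all_classical all_reals all_analysis.
From mathcomp Require Import ring lra sesquilinear spectral complex.
Import Order.TTheory GRing.Theory Num.Theory.
Import numFieldNormedType.Exports.
Local Open Scope classical_set_scope.
Local Open Scope ring_scope.
Local Open Scope sesquilinear_scope.

Set Implicit Arguments.
Unset Strict Implicit.
Unset Printing Implicit Defensive.

(** Joins completeness to the normed module structure, so that absolutely convergent matrix series
    converge. *)
HB.instance Definition _ (R : realType) m n := Complete.on 'M[R]_(m, n).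

(** * Series dominated by the real exponential series *)

Section ExpSeries.
Context {R : realType} {V : completeNormedModType R}.
Implicit Types (u : nat -> V) (C a : R).

(** The bound [C * a ^+ k] is the common form of the later estimates: powers, their derivatives and
    their Taylor remainders. *)
Lemma norm_exp_series_le u C a k : `|u k| <= C * a ^+ k ->
  `|(k`!%:R)^-1 *: u k| <= (C *: exp_coeff a) k.
Proof.
move=> uC; rewrite normrZ ger0_norm ?invr_ge0// mulrC.
rewrite [leRHS](_ : _ = C * a ^+ k / k`!%:R); last exact: mulrA.
by rewrite ler_pM2r ?invr_gt0 ?ltr0n ?fact_gt0.
Qed.

Lemma is_cvg_normed_exp_series u C a : (forall k, `|u k| <= C * a ^+ k) ->
  cvgn [normed series (fun k => (k`!%:R)^-1 *: u k)].
Proof.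
move=> uC; apply: (@series_le_cvg _ _ (C *: exp_coeff a)) => [k|k|k|].
- exact: normr_ge0.
- by apply: le_trans (norm_exp_series_le (uC k)).
- exact: norm_exp_series_le.
- exact/is_cvg_seriesZ/is_cvg_series_exp_coeff.
Qed.

Lemma is_cvg_exp_series u C a : (forall k, `|u k| <= C * a ^+ k) ->
  cvgn (series (fun k => (k`!%:R)^-1 *: u k)).
Proof. by move=> /is_cvg_normed_exp_series /normed_cvg. Qed.

Lemma norm_lim_exp_series u C a : (forall k, `|u k| <= C * a ^+ k) ->
  `|limn (series (fun k => (k`!%:R)^-1 *: u k))| <= C * expR a.
Proof.
move=> uC; apply: (le_trans (lim_series_norm (is_cvg_normed_exp_series uC))).
rewrite [leRHS](_ : _ = limn (series (C *: exp_coeff a))).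
  apply: lim_series_le (is_cvg_normed_exp_series uC) _ _.
    exact/is_cvg_seriesZ/is_cvg_series_exp_coeff.
  by move=> k; exact: norm_exp_series_le.
by rewrite lim_seriesZ //; exact: is_cvg_series_exp_coeff.
Qed.
End ExpSeries.

(** * Maximum norm of matrices and convergence of the exponential *)

Section MatrixExp.
Context {R : realType}.

Lemma norm_mx_coord m n (M : 'M[R]_(m, n)) i j : `|M i j| <= `|M|.
Proof.
rewrite [leRHS]mx_normrE.
exact: (le_bigmax _ (fun ij : 'I_m * 'I_n => `|M ij.1 ij.2|) (i, j)).
Qed.

(** The maximum norm is not submultiplicative: an entry of the product sums n terms, whence the
    factor [n%:R]. *)
Lemma norm_mulmx m n p (A : 'M[R]_(m, n)) (B : 'M[R]_(n, p)) :
  `|A *m B| <= n%:R * `|A| * `|B|.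
Proof.
rewrite {1}[`|_ *m _|]mx_normrE; apply/bigmax_leP; split=> [|[i j] _ /=].
  by rewrite !mulr_ge0.
rewrite mxE; apply: le_trans (ler_norm_sum _ _ _) _.
rewrite -mulrA mulr_natl -[X in _ *+ X](card_ord n) -sumr_const.
by apply: ler_sum => k _; rewrite normrM ler_pM// norm_mx_coord.
Qed.

Variable n : nat.
Implicit Types (X Y H : 'M[R]_n).

(** Only an inequality, since the norm is 0 when n = 0. *)
Lemma norm_mx1 : `|1 : 'M[R]_n| <= 1.
Proof.
rewrite [leLHS]mx_normrE; apply/bigmax_leP; split=> [//|[i j] _ /=].
by rewrite mxE; case: eqP => _; rewrite ?normr1 ?normr0.
Qed.

Lemma norm_exprmx X k : `|X ^+ k| <= (n%:R * `|X|) ^+ k.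
Proof.
elim: k => [|k IH]; first by rewrite !expr0 norm_mx1.
rewrite !exprS; apply: le_trans (norm_mulmx X (X ^+ k)) _.
by apply: ler_pM => //; rewrite mulr_ge0.
Qed.

Lemma expm_cvg X : series (fun k => (k`!%:R)^-1 *: X ^+ k) @ \oo --> expm X.
Proof.
apply: (@is_cvg_exp_series _ _ _ 1 (n%:R * `|X|)) => k.
by rewrite mul1r norm_exprmx.
Qed.
End MatrixExp.
Arguments expm_cvg {R n} X.

(** * Linear operations on convergent series *)

Section SeriesLinear.
Context {R : realType}.

Lemma cvg_seriesDZ (V : normedModType R) (u v : nat -> V) c a b :
  series u @ \oo --> a -> series v @ \oo --> b ->
  series (fun k => c *: u k + v k) @ \oo --> c *: a + b.
Proof.
move=> ua vb; rewrite -[X in series X]/(c *: u + v) seriesD seriesZ.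
exact: cvgD (cvgZl_tmp ua) vb.
Qed.

Lemma cvg_seriesB (V : normedModType R) (u v : nat -> V) a b :
  series u @ \oo --> a -> series v @ \oo --> b ->
  series (fun k => u k - v k) @ \oo --> a - b.
Proof.
move=> ua vb; rewrite -[X in series X]/(u - v) seriesD seriesN.
exact: cvgB.
Qed.

Lemma cvg_series_linear (V W : normedModType R) (f : {linear V -> W})
    (u : nat -> V) a :
  continuous f -> series u @ \oo --> a -> series (f \o u) @ \oo --> f a.
Proof.
move=> fc ua; rewrite (_ : series _ = f \o series u).
  exact: cvg_comp ua (fc a).
by apply/funext => k; rewrite /series /= linear_sum.
Qed.

End SeriesLinear.

(** * The differential of the exponential *)

Section Differential.
Context {R : realType} {n : nat}.
Implicit Types (X Y H : 'M[R]_n).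

Lemma norm_mulrmx X Y : `|X * Y| <= (n%:R * `|X|) * `|Y|.
Proof. exact: (norm_mulmx X Y). Qed.

Lemma mulrZmx a X Y : X * (a *: Y) = a *: (X * Y).
Proof. by rewrite -!mulmxE scalemxAr. Qed.

Lemma mulZrmx a X Y : (a *: X) * Y = a *: (X * Y).
Proof. by rewrite -!mulmxE scalemxAl. Qed.

Lemma cvg_series_mulmxl Y (u : nat -> 'M[R]_n) (A : 'M[R]_n) :
  series u @ \oo --> A ->
  series (fun k => Y * u k) @ \oo --> Y * A.
Proof.
have lin : linear ( *%R Y : 'M[R]_n -> 'M[R]_n).
  by move=> a U V; rewrite mulrDr mulrZmx.
pose L := GRing.isLinear.Build _ _ _ _ _ lin.
pose f : {linear 'M[R]_n -> 'M[R]_n} := HB.pack ( *%R Y : 'M[R]_n -> 'M[R]_n) L.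
apply: (@cvg_series_linear _ _ _ f).
apply: bounded_linear_continuous; apply/linear_boundedP; near=> r => U.
apply: le_trans (norm_mulrmx _ _) _.
by apply: ler_wpM2r => //; near: r; apply: nbhs_pinfty_ge; rewrite num_real.
Unshelve. all: by end_near. Qed.

Arguments cvg_series_mulmxl Y {u A}.

Lemma cvg_series_mulmxr Y (u : nat -> 'M[R]_n) (A : 'M[R]_n) :
  series u @ \oo --> A ->
  series (fun k => u k * Y) @ \oo --> A * Y.
Proof.
have lin : linear ( *%R^~ Y : 'M[R]_n -> 'M[R]_n).
  by move=> a U V; rewrite mulrDl mulZrmx.
pose L := GRing.isLinear.Build _ _ _ _ _ lin.
pose f : {linear 'M[R]_n -> 'M[R]_n} :=
  HB.pack ( *%R^~ Y : 'M[R]_n -> 'M[R]_n) L.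
apply: (@cvg_series_linear _ _ _ f).
apply: bounded_linear_continuous; apply/linear_boundedP; near=> r => U.
apply: le_trans (norm_mulrmx _ _) _; rewrite mulrAC.
by apply: ler_wpM2r => //; near: r; apply: nbhs_pinfty_ge; rewrite num_real.
Unshelve. all: by end_near. Qed.

Arguments cvg_series_mulmxr Y {u A}.

Section AtPoint.
Variable X : 'M[R]_n.

(** The sum of X^i H X^(k-1-i) over i < k, that is, the derivative of the k-th power at X along H;
    the recursion is the Leibniz rule for X X^k. *)
Fixpoint expr_diff H k : 'M[R]_n :=
  if k is k'.+1 then X * expr_diff H k' + H * X ^+ k' else 0.

(** The exponential series differentiated term by term; [diff_expm] identifies it with the
    differential. *)
Definition dexpm H : 'M[R]_n :=
  limn (series (fun k => (k`!%:R)^-1 *: expr_diff H k)).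

(** The summand 1 makes m >= 1 and lets m also bound n |H + X| whenever n |H| <= 1. *)
Let m : R := n%:R * `|X| + 1.

Let m1 : 1 <= m. Proof. by rewrite lerDr mulr_ge0. Qed.
Let m0 : 0 <= m. Proof. exact: le_trans m1. Qed.

Let norm_exprX k : `|X ^+ k| <= m ^+ k.
Proof.
apply: le_trans (norm_exprmx _ _) _.
apply: lerXn2r; rewrite ?nnegrE ?mulr_ge0//.
by rewrite lerDl.
Qed.

(** Each step of the recursion multiplies the bound by at most m + 1 <= 2 m. *)
Lemma norm_expr_diff H k :
  `|expr_diff H k| <= (n%:R * `|H|) * (2 * m) ^+ k.
Proof.
have h0 : 0 <= n%:R * `|H| by rewrite mulr_ge0.
elim: k => [|k IH]; first by rewrite /= normr0 mulr1.
apply: le_trans (ler_normD _ _) _.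
have p0 : 0 <= (2 * m) ^+ k by rewrite exprn_ge0// mulr_ge0.
apply: (@le_trans _ _ (m * (n%:R * `|H| * (2 * m) ^+ k)
  + n%:R * `|H| * (2 * m) ^+ k)).
  apply: lerD; apply: le_trans (norm_mulrmx _ _) _.
    by apply: ler_pM; rewrite ?mulr_ge0// lerDl.
  apply: ler_wpM2l => //; apply: le_trans (norm_exprX _) _.
  by apply: lerXn2r; rewrite ?nnegrE ?mulr_ge0// ler_peMl// ler1n.
rewrite exprS; set a := n%:R * _; set b := (2 * m) ^+ k in p0 *.
have := mulr_ge0 (mulr_ge0 h0 p0) (_ : 0 <= m - 1); rewrite subr_ge0 => /(_ m1).
rewrite -/a; nra.
Qed.

Lemma dexpm_cvg H :
  series (fun k => (k`!%:R)^-1 *: expr_diff H k) @ \oo --> dexpm H.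
Proof. exact: is_cvg_exp_series (norm_expr_diff H). Qed.
Arguments dexpm_cvg : clear implicits.

Lemma norm_dexpm H : `|dexpm H| <= (n%:R * `|H|) * expR (2 * m).
Proof. exact: norm_lim_exp_series (norm_expr_diff H). Qed.

Lemma dexpm_linear : linear dexpm.
Proof.
move=> a U V; apply: cvg_lim => //.
have -> : (fun k => (k`!%:R)^-1 *: expr_diff (a *: U + V) k) =
  (fun k => a *: ((k`!%:R)^-1 *: expr_diff U k) + (k`!%:R)^-1 *: expr_diff V k).
  apply/funext => k; rewrite scalerA [a * _]mulrC -scalerA -scalerDr.
  congr (_ *: _); elim: k => [|k /= ->]; first by rewrite /= scaler0 addr0.
  by rewrite mulrDl mulrDr scalerDr !mulZrmx mulrZmx addrACA.
refine (@cvg_seriesDZ _ 'M[R]_n _ _ _ _ _ (dexpm_cvg U) (dexpm_cvg V)).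
Qed.

HB.instance Definition _ := GRing.isLinear.Build _ _ _ _ dexpm dexpm_linear.

Lemma dexpm_continuous : continuous dexpm.
Proof.
apply: bounded_linear_continuous; apply/linear_boundedP; near=> r => U.
apply: le_trans (norm_dexpm _) _; rewrite mulrAC.
by apply: ler_wpM2r => //; near: r; apply: nbhs_pinfty_ge; rewrite num_real.
Unshelve. all: by end_near. Qed.

(** The remainders satisfy r_(k+1) = (H + X) r_k + H [expr_diff H k], so with n |H + X| <= m each
    step costs at most a factor 3 m. *)
Lemma norm_expr_taylor H k : n%:R * `|H| <= 1 ->
  `|(H + X) ^+ k - X ^+ k - expr_diff H k|
    <= (n%:R * `|H|) ^+ 2 * (3 * m) ^+ k.
Proof.
set h := n%:R * `|H| => h1; have h0 : 0 <= h by rewrite mulr_ge0.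
elim: k => [|k IH]; first by rewrite /= !expr0 subrr subr0 normr0 mulr1 sqr_ge0.
rewrite [X in `|X|](_ : _ = (H + X) * ((H + X) ^+ k - X ^+ k - expr_diff H k)
  + H * expr_diff H k); last first.
  rewrite !exprS /= !mulrBr !mulrDl [in RHS]opprD -!addrA; congr (_ + (_ + _)).
  by rewrite !opprD; move: (X * X ^+ k) (H * X ^+ k) (X * expr_diff H k)
    (H * expr_diff H k) => a b c d; rewrite [RHS]addrCA; congr (_ + _);
    rewrite [LHS]addrC; congr (_ + _); rewrite addrAC addNr add0r.
have p0 : 0 <= (3 * m) ^+ k by rewrite exprn_ge0// mulr_ge0.
apply: le_trans (ler_normD _ _) _.
apply: (@le_trans _ _ (m * (h ^+ 2 * (3 * m) ^+ k) + h * (h * (3 * m) ^+ k))).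
  apply: lerD; apply: le_trans (norm_mulrmx _ _) _.
    apply: ler_pM; rewrite ?mulr_ge0//.
    apply: le_trans (_ : n%:R * (`|H| + `|X|) <= _).
      by rewrite ler_wpM2l// ler_normD.
    by rewrite mulrDr addrC lerD2l.
  rewrite -/h; apply: ler_wpM2l => //; apply: le_trans (norm_expr_diff _ _) _.
  rewrite -/h; apply: ler_wpM2l => //; apply: lerXn2r;
    rewrite ?nnegrE ?mulr_ge0// ler_wpM2r// ler_nat.
  by [].
rewrite [_ ^+ k.+1]exprS; set b := (3 * m) ^+ k in p0 *.
have := mulr_ge0 (mulr_ge0 (sqr_ge0 h) p0) (_ : 0 <= m - 1).
have := mulr_ge0 (mulr_ge0 (sqr_ge0 h) p0) m0.
rewrite subr_ge0 => ? /(_ m1); nra.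
Qed.

Lemma norm_expm_taylor H : n%:R * `|H| <= 1 ->
  `|expm (H + X) - expm X - dexpm H| <= (n%:R * `|H|) ^+ 2 * expR (3 * m).
Proof.
move=> h1.
apply: le_trans (norm_lim_exp_series (fun k => norm_expr_taylor k h1)).
rewrite le_eqVlt; apply/orP; left; apply/eqP; congr `|_|; apply/esym.
apply: cvg_lim => //.
have -> : (fun k => (k`!%:R)^-1 *: ((H + X) ^+ k - X ^+ k - expr_diff H k)) =
  (fun k => (k`!%:R)^-1 *: (H + X) ^+ k - (k`!%:R)^-1 *: X ^+ k
            - (k`!%:R)^-1 *: expr_diff H k).
  by apply/funext => k; rewrite !scalerBr.
refine (@cvg_seriesB _ 'M[R]_n _ _ _ _ _ (dexpm_cvg H)).
exact: (@cvg_seriesB _ 'M[R]_n _ _ _ _ (expm_cvg _) (expm_cvg _)).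
Qed.

Lemma diff_expm : 'd (@expm R n) X = dexpm :> ('M[R]_n -> 'M[R]_n).
Proof.
apply: diff_unique; first exact: dexpm_continuous.
apply/eqaddoP => _/posnumP[e]; near=> H.
rewrite /= -[X in `|X|]/(expm (H + X) - (expm X + dexpm H)) opprD addrA.
have K0 : 0 < n%:R ^+ 2 * expR (3 * m) + 1 :> R.
  by rewrite ltr_wpDl// mulr_ge0// ?sqr_ge0// expR_ge0.
(* This radius gives n |H| <= 1, as the Taylor bound asks; the next one makes the quadratic
   remainder at most e |H|. Each + 1 keeps a denominator positive when n = 0. *)
have H1 : `|H| <= (n%:R + 1)^-1.
  by near: H; apply: (@nbhs0_le _ 'M[R]_n); rewrite invr_gt0 ltr_wpDl.
have H2 : `|H| <= e%:num / (n%:R ^+ 2 * expR (3 * m) + 1).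
  by near: H; apply: (@nbhs0_le _ 'M[R]_n); rewrite divr_gt0.
apply: le_trans (norm_expm_taylor _) _.
  apply: le_trans (_ : (n%:R + 1) * `|H| <= _).
    by rewrite ler_wpM2r// lerDl.
  by rewrite -ler_pdivlMl ?mulr1// ltr_wpDl.
rewrite exprMn mulrAC expr2 mulrA ler_wpM2r//.
move: H2; rewrite ler_pdivlMr// => H2; apply: le_trans H2.
by rewrite mulrC ler_wpM2l// lerDl.
Unshelve. all: by end_near. Qed.

End AtPoint.

(** The commutator with Y is a derivation, so on X^k it equals the derivative of the k-th power
    along its value at X. *)
Lemma expr_diff_commutator X Y k :
  expr_diff X (Y * X - X * Y) k = Y * X ^+ k - X ^+ k * Y.
Proof.
elim: k => [|k /= ->]; first by rewrite /= expr0 mulr1 mul1r subrr.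
rewrite mulrBr mulrBl !mulrA -exprS -(mulrA Y) -exprS; set a := X * Y * _.
by rewrite addrC addrA subrK.
Qed.

(** Turns commutation of Y with [expm X] into membership of Y X - X Y in the kernel of the
    differential at X. *)
Lemma dexpm_commutator X Y :
  dexpm X (Y * X - X * Y) = Y * expm X - expm X * Y.
Proof.
apply: cvg_lim => //.
have -> : (fun k => (k`!%:R)^-1 *: expr_diff X (Y * X - X * Y) k) =
  (fun k => Y * ((k`!%:R)^-1 *: X ^+ k) - ((k`!%:R)^-1 *: X ^+ k) * Y).
  by apply/funext => k; rewrite expr_diff_commutator scalerBr mulrZmx mulZrmx.
refine (@cvg_seriesB _ 'M[R]_n _ _ _ _ (cvg_series_mulmxl Y (expm_cvg X))
  (cvg_series_mulmxr Y (expm_cvg X))).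
Qed.

End Differential.

(** * The exponential of a sum of commuting matrices *)

Section Multiplicativity.

(** For Cauchy products: a product of partial sums fills a square, the partial sum of the product
    series the triangle i + j < N, and the corner i + j >= N remains. An arbitrary additive group
    covers both matrices and reals. *)
Lemma sum_square_sub_triangle (V : zmodType) (F : nat -> nat -> V) N :
  \sum_(0 <= i < N) \sum_(0 <= j < N) F i j
    - \sum_(0 <= k < N) \sum_(0 <= i < k.+1) F i (k - i)%N
  = \sum_(0 <= i < N) \sum_(N - i <= j < N) F i j.
Proof.
(* Regroups the antidiagonals of the triangle into rows. *)
have tri M : \sum_(0 <= k < M) \sum_(0 <= i < k.+1) F i (k - i)%N
    = \sum_(0 <= i < M) \sum_(0 <= j < M - i) F i j.
  elim: M => [|M IH]; first by rewrite !big_geq.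
  rewrite big_nat_recr//= IH [RHS]big_nat_recr//= subSnn big_nat1.
  rewrite [X in _ + X]big_nat_recr//= subnn addrA; congr (_ + _).
  rewrite -big_split /=; apply: eq_big_nat => i /andP[_ iM].
  by rewrite subSn 1?ltnW// big_nat_recr.
rewrite tri -sumrB; apply: eq_big_nat => i _.
by by rewrite [X in X - _](@big_cat_nat _ _ _ (N - i)%N) ?leq_subr//=
  addrAC subrr add0r.
Qed.

Context {R : realType}.

Lemma natr_binomial_fact (k i : nat) : (i <= k)%N ->
  (k`!%:R)^-1 * 'C(k, i)%:R = (i`!%:R)^-1 * ((k - i)`!%:R)^-1 :> R.
Proof.
move=> ik; have f0 j : j`!%:R != 0 :> R by rewrite pnatr_eq0 -lt0n fact_gt0.
rewrite -(bin_fact ik) !natrM; field.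
by rewrite !f0 pnatr_eq0 -lt0n bin_gt0.
Qed.

Section Matrices.
Variable n : nat.
Implicit Types A B : 'M[R]_n.

Lemma scaled_exprD_comm A B k : A * B = B * A ->
  (k`!%:R)^-1 *: (A + B) ^+ k = \sum_(0 <= i < k.+1)
     ((i`!%:R)^-1 * ((k - i)`!%:R)^-1) *: (A ^+ i * B ^+ (k - i)).
Proof.
move=> cAB; rewrite addrC exprDn_comm; last exact/esym.
rewrite big_mkord scaler_sumr; apply: eq_bigr => -[i /= ik] _.
rewrite -(@scaler_nat R 'M[R]_n) scalerA natr_binomial_fact//; congr (_ *: _).
by apply/esym/commrX/commr_sym/commrX.
Qed.

Lemma cvg_mulrmx (u v : nat -> 'M[R]_n) A B :
  u @ \oo --> A -> v @ \oo --> B -> (fun k => u k * v k) @ \oo --> A * B.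
Proof.
(* The bound comes from u v - A B = (u - A) v + A (v - B). *)
move=> uA vB; pose w k := n%:R * `|u k - A| * `|v k| + n%:R * `|A| * `|v k - B|.
have w0 : w @ \oo --> (0 : R).
  have uA0 : (fun k => `|u k - A|) @ \oo --> (0 : R).
    by rewrite -(@normr0 _ 'M[R]_n) -(subrr A); apply: cvg_norm;
      apply: cvgB uA (cvg_cst _).
  have vB0 : (fun k => `|v k - B|) @ \oo --> (0 : R).
    by rewrite -(@normr0 _ 'M[R]_n) -(subrr B); apply: cvg_norm;
      apply: cvgB vB (cvg_cst _).
  rewrite -[X in _ --> X](_ : n%:R * 0 * `|B| + n%:R * `|A| * 0 = 0);
    last by rewrite !mulr0 mul0r addr0.
  apply: cvgD; apply: cvgM => //; first exact: cvgMl_tmp.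
    exact: cvg_norm.
  exact: cvg_cst.
apply/subr_cvg0; apply: norm_cvg0; apply: squeeze_cvgr (cvg_cst 0) w0; near=> k.
rewrite normr_ge0/= (_ : u k * v k - A * B = (u k - A) * v k + A * (v k - B)).
  by rewrite (le_trans (ler_normD _ _))// lerD// norm_mulrmx.
by rewrite mulrBl mulrBr addrA subrK.
Unshelve. all: by end_near. Qed.

End Matrices.

Lemma exp_coeffD (a b : R) k : exp_coeff (a + b) k =
  \sum_(0 <= i < k.+1) exp_coeff a i * exp_coeff b (k - i)%N.
Proof.
rewrite /exp_coeff /= addrC exprDn mulr_suml big_mkord.
apply: eq_bigr => -[i /= ik] _.
rewrite -mulr_natr.
transitivity (a ^+ i * b ^+ (k - i) * ((k`!%:R)^-1 * 'C(k, i)%:R)).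
  by ring.
by rewrite natr_binomial_fact//; ring.
Qed.

(* The difference between the product of partial sums and the partial sum for
   A + B is dominated termwise by n times its analogue for real exponentials. *)
Lemma expmD n (A B : 'M[R]_n) : A * B = B * A ->
  expm (A + B) = expm A * expm B.
Proof.
move=> cAB.
set E := fun X : 'M[R]_n => series (fun k => (k`!%:R)^-1 *: X ^+ k).
have EAB : (fun N => E A N * E B N - E (A + B) N) @ \oo
    --> expm A * expm B - expm (A + B).
  by apply: cvgB (expm_cvg _); apply: cvg_mulrmx; exact: expm_cvg.
pose a := n%:R * `|A|; pose b := n%:R * `|B|.
have a0 : 0 <= a by rewrite mulr_ge0.
have b0 : 0 <= b by rewrite mulr_ge0.
pose e x : R^nat := series (exp_coeff x).
have ce x : e x @ \oo --> expR x by exact: is_cvg_series_exp_coeff.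
(* For real numbers the corner sums tend to 0 by the functional equation of [expR]. *)
have eab : (fun N => n%:R * (e a N * e b N - e (a + b) N)) @ \oo --> (0 : R).
  rewrite -[X in _ --> X](mulr0 n%:R) -[X in _ * X](subrr (expR (a + b))).
  rewrite [X in X - _]expRD.
  by apply: cvgMl_tmp; apply: cvgB => //; apply: cvgM.
suff E0 : (fun N => E A N * E B N - E (A + B) N) @ \oo --> (0 : 'M[R]_n).
  by apply/esym/subr0_eq; rewrite -(cvg_lim _ EAB)// (cvg_lim _ E0).
apply: norm_cvg0; apply: squeeze_cvgr (cvg_cst 0) eab; near=> N.
rewrite normr_ge0/=.
have -> : E A N * E B N - E (A + B) N =
  \sum_(0 <= i < N) \sum_(N - i <= j < N)
     ((i`!%:R)^-1 * (j`!%:R)^-1) *: (A ^+ i * B ^+ j).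
  rewrite -sum_square_sub_triangle; congr (_ - _).
    rewrite /E /series /= mulr_suml; apply: eq_bigr => i _.
    rewrite mulr_sumr; apply: eq_bigr => j _.
    by rewrite mulrZmx mulZrmx scalerA mulrC.
  by rewrite /E /series /=; apply: eq_bigr => k _; exact: scaled_exprD_comm.
have -> : e a N * e b N - e (a + b) N =
  \sum_(0 <= i < N) \sum_(N - i <= j < N) exp_coeff a i * exp_coeff b j.
  rewrite -sum_square_sub_triangle; congr (_ - _).
    by rewrite /e /series /= mulr_suml; apply: eq_bigr => i _;
      rewrite mulr_sumr.
  by rewrite /e /series /=; apply: eq_bigr => k _; exact: exp_coeffD.
rewrite mulr_sumr; apply: le_trans (ler_norm_sum _ _ _) _.
apply: ler_sum => i _; rewrite mulr_sumr.
apply: le_trans (ler_norm_sum _ _ _) _.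
apply: ler_sum => j _; rewrite normrZ ger0_norm ?mulr_ge0 ?invr_ge0//.
rewrite /exp_coeff /= [leRHS](_ : _ = (i`!%:R)^-1 * (j`!%:R)^-1 *
  (n%:R * a ^+ i * b ^+ j)); last by ring.
apply: ler_wpM2l; first by rewrite mulr_ge0 ?invr_ge0.
apply: le_trans (norm_mulrmx _ _) _.
by apply: ler_pM; rewrite ?mulr_ge0 ?norm_exprmx// ler_wpM2l// norm_exprmx.
Unshelve. all: by end_near. Qed.

End Multiplicativity.

(** * Real eigenvectors of symmetric matrices *)

Section SpectralFrame.
Context {R : realType}.

Lemma complex_Re_sum (I : finType) (F : I -> R[i]) :
  complex.Re (\sum_i F i) = \sum_i complex.Re (F i).
Proof. by apply: (big_morph (@complex.Re R)) => // -[a b] [c d]. Qed.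

Lemma complex_Im_sum (I : finType) (F : I -> R[i]) :
  complex.Im (\sum_i F i) = \sum_i complex.Im (F i).
Proof. by apply: (big_morph (@complex.Im R)) => // -[a b] [c d]. Qed.

(* The w i are the real and imaginary parts of a complex unitary eigenbasis: a
   tight frame of eigenvectors rather than a basis, so some may vanish. *)
Lemma symmetric_eigenframe n (A : 'M[R]_n) : A^T = A ->
  exists (I : finType) (w : I -> 'cV[R]_n) (c : I -> R),
    (forall i, A *m w i = c i *: w i) /\ \sum_i w i *m (w i)^T = 1%:M.
Proof.
move=> Asym; pose A' := map_mx (real_complex R) A.
have A'herm : A' \is hermsymmx.
  apply: realsym_hermsym.
    apply/is_hermitianmxP; rewrite expr0 scale1r map_mx_id//.
    by apply/matrixP => i j; rewrite !mxE -[in LHS]Asym mxE.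
  apply/mxOverP => i j; rewrite mxE.
  by apply/CrealP; exact: conjc_real.
set P := spectralmx A'; set d := spectral_diag A'.
have Pu : P \is unitarymx by exact: spectral_unitarymx.
have dreal i : complex.Im (d 0 i) = 0.
  have /mxOverP/(_ 0 i)/CrealP := hermitian_spectral_diag_real A'herm.
  rewrite -/d; case: (d 0 i) => a b /= [] /eqP.
  by rewrite eq_sym -addr_eq0 -mulr2n mulrn_eq0 => /eqP.
have PA : P *m A' = diag_mx d *m P.
  have /hermitian_normalmx/orthomx_spectralP := A'herm => ->.
  by rewrite -/P -/d -!mulmxA mulKVmx// unitarymx_unit.
have PP : P^t* *m P = 1%:M by rewrite -invmx_unitary// mulVmx// unitarymx_unit.
(* The rows of P are left eigenvectors of [A'], hence right ones by symmetry; as the eigenvalues are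
   real, real and imaginary parts are eigenvectors of A separately. *)
pose w (i : 'I_n + 'I_n) : 'cV[R]_n := match i with
  | inl i => \col_j complex.Re (P i j) | inr i => \col_j complex.Im (P i j) end.
pose c (i : 'I_n + 'I_n) := match i with
  | inl i => complex.Re (d 0 i) | inr i => complex.Re (d 0 i) end.
have ReM (z x : R[i]) : complex.Im z = 0 ->
    complex.Re (z * x) = complex.Re z * complex.Re x.
  by case: z x => [a b] [p q] /= ->; rewrite mul0r subr0.
have ImM (z x : R[i]) : complex.Im z = 0 ->
    complex.Im (z * x) = complex.Re z * complex.Im x.
  by case: z x => [a b] [p q] /= ->; rewrite mul0r addr0.
have PAij i j : \sum_k P i k * (A j k)%:C%C = d 0 i * P i j.
  have /matrixP/(_ i j) := PA; rewrite mul_diag_mx !mxE => <-.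
  by apply: eq_bigr => k _; rewrite !mxE -[in LHS]Asym mxE.
exists ('I_n + 'I_n)%type, w, c; split=> [[i|i]|].
- apply/colP => j; rewrite !mxE.
  have /(congr1 (@complex.Re R)) := PAij i j.
  rewrite complex_Re_sum ReM// => <-.
  by apply: eq_bigr => k _; rewrite mxE [P i k * _]mulrC ReM.
- apply/colP => j; rewrite !mxE.
  have /(congr1 (@complex.Im R)) := PAij i j.
  rewrite complex_Im_sum ImM// => <-.
  by apply: eq_bigr => k _; rewrite mxE [P i k * _]mulrC ImM.
(* The real part of [PP], since conj p times q has real part Re p Re q + Im p Im q. *)
apply/matrixP => j k; rewrite big_sumType/= mxE !summxE -big_split/=.
have /matrixP/(_ j k)/(congr1 (@complex.Re R)) := PP.
rewrite !mxE complex_Re_sum => PPjk.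
transitivity (complex.Re ((j == k)%:R : R[i])); last by case: (j == k).
rewrite -PPjk; apply: eq_bigr => i _; rewrite !mxE !big_ord1 !mxE.
have -> : ((P i j)^* )%R = conjc (P i j) by [].
by case: (P i j) => a b; case: (P i k) => x y /=; rewrite mulNr opprK.
Qed.

End SpectralFrame.

(** * Frobenius and spectral norms *)

Section FrobeniusNorm.
Context {R : realType}.

Lemma frobnorm_ge0 p q (A : 'M[R]_(p, q)) : 0 <= frobnorm A.
Proof. exact: sqrtr_ge0. Qed.

Lemma sqr_frobnorm p q (A : 'M[R]_(p, q)) : frobnorm A ^+ 2 = \tr (A^T *m A).
Proof.
rewrite sqr_sqrtr; last by do 2![apply: sumr_ge0 => ? _]; exact: sqr_ge0.
rewrite exchange_big; apply: eq_bigr => i _; rewrite mxE.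
by apply: eq_bigr => j _; rewrite mxE expr2.
Qed.

Lemma frobnorm_eq0 p q (A : 'M[R]_(p, q)) : frobnorm A = 0 -> A = 0.
Proof.
move=> /(congr1 (fun x => x ^+ 2)); rewrite expr0n/= sqr_sqrtr; last first.
  by do 2![apply: sumr_ge0 => ? _]; exact: sqr_ge0.
move=> /psumr_eq0P A0; apply/matrixP => i j; rewrite mxE; apply/eqP.
have /psumr_eq0P Ai0 :=
  A0 (fun i _ => sumr_ge0 _ (fun j _ => sqr_ge0 (A i j))) i isT.
by rewrite -sqrf_eq0 (Ai0 (fun j _ => sqr_ge0 (A i j)) j isT).
Qed.

Lemma frobnorm0 p q : frobnorm (0 : 'M[R]_(p, q)) = 0.
Proof.
by apply/eqP; rewrite -sqrf_eq0 sqr_frobnorm mulmx0 mxtrace0.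
Qed.

Lemma frobnormZ p q a (A : 'M[R]_(p, q)) :
  frobnorm (a *: A) = `|a| * frobnorm A.
Proof.
apply/eqP; rewrite -(eqrXn2 (n := 2)) ?mulr_ge0 ?frobnorm_ge0//.
rewrite exprMn !sqr_frobnorm real_normK ?num_real//.
have -> : (a *: A)^T = a *: A^T by rewrite linearZ.
by rewrite -scalemxAr -scalemxAl scalerA mxtraceZ expr2.
Qed.

(** Parseval's identity for a tight frame: the resolution of the identity is inserted into the trace
    of M^T M. *)
Lemma sqr_frobnorm_frame p n (I : finType) (w : I -> 'cV[R]_n)
    (M : 'M[R]_(p, n)) : \sum_i w i *m (w i)^T = 1%:M ->
  frobnorm M ^+ 2 = \sum_i frobnorm (M *m w i) ^+ 2.
Proof.
move=> w1; rewrite sqr_frobnorm -[_ *m M]mulmx1 -w1.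
rewrite mulmx_sumr raddf_sum; apply: eq_bigr => i _ /=.
by rewrite mulmxA mxtrace_mulC sqr_frobnorm trmx_mul !mulmxA.
Qed.

Lemma frobnorm_mul_le n (X : 'M[R]_n) (v : 'cV[R]_n) :
  frobnorm (X *m v) <= specnorm X * frobnorm v.
Proof.
have [v0|v0] := eqVneq (frobnorm v) 0.
  by rewrite (frobnorm_eq0 v0) mulmx0 !frobnorm0 mulr0.
have vp : 0 < frobnorm v by rewrite lt_neqAle eq_sym v0 frobnorm_ge0.
rewrite -ler_pdivrMr// mulrC.
have -> : (frobnorm v)^-1 * frobnorm (X *m v)
    = frobnorm (X *m ((frobnorm v)^-1 *: v)).
  by rewrite -scalemxAr frobnormZ ger0_norm ?invr_ge0 ?frobnorm_ge0.
apply: ub_le_sup; last first.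
  exists ((frobnorm v)^-1 *: v) => //=.
  by rewrite frobnormZ ger0_norm ?invr_ge0 ?frobnorm_ge0// mulVf.
(* [sup] bounds its members only if the set is bounded above. Entries of a vector in the unit ball
   are at most 1 in absolute value, so absolute row sums of X suffice. *)
exists (Num.sqrt (\sum_i (\sum_j `|X i j|) ^+ 2)) => _ [u /= u1 <-].
rewrite ler_wsqrtr//; apply: ler_sum => i _; rewrite big_ord1 mxE.
rewrite -[leLHS]real_normK ?num_real//.
apply: lerXn2r; rewrite ?nnegrE ?sumr_ge0//.
apply: le_trans (ler_norm_sum _ _ _) _; apply: ler_sum => j _.
rewrite normrM ler_piMr//.
rewrite -(@ler_pXn2r _ 2) ?nnegrE// expr1n real_normK ?num_real//.
have : frobnorm u ^+ 2 <= 1 by rewrite expr_le1// frobnorm_ge0.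
apply: le_trans; rewrite sqr_sqrtr; last first.
  by do 2![apply: sumr_ge0 => ? _]; exact: sqr_ge0.
rewrite (bigD1 j)//= big_ord1 lerDl.
by do 2![apply: sumr_ge0 => ? _]; exact: sqr_ge0.
Qed.

(** The two sides differ by twice the squared norm of A/2 + B. *)
Lemma sqr_frobnormD_ge p q (A B : 'M[R]_(p, q)) :
  frobnorm A ^+ 2 / 2 - frobnorm B ^+ 2 <= frobnorm (A + B) ^+ 2.
Proof.
have : 0 <= frobnorm ((2^-1 : R) *: A + B) ^+ 2 by exact: sqr_ge0.
rewrite !sqr_frobnorm !raddfD/=.
have -> : ((2^-1 : R) *: A)^T = 2^-1 *: A^T by rewrite linearZ.
rewrite !(mulmxDl, mulmxDr).
rewrite -!scalemxAl -!scalemxAr !mxtraceD !mxtraceZ.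
rewrite [\tr (B^T *m A)]mxtrace_mulC.
rewrite -[\tr (A *m B^T)]mxtrace_tr trmx_mul trmxK.
set x := \tr (B *m A^T); rewrite [\tr (A^T *m B)]mxtrace_mulC -/x.
lra.
Qed.

End FrobeniusNorm.

(** * Skew logarithms of one matrix and their distances *)

Section SkewExponential.
Context {R : realType} {n : nat}.
Implicit Types (D E L Y : 'M[R]_n).

(** If 0 < x < 2 pi, then sin (x/2) > 0 and cos x = 1 - 2 sin^2 (x/2) < 1. *)
Lemma cos_eq1_ge (x : R) : 0 < x -> cos x = 1 -> 2 * pi <= x.
Proof.
move=> x0 cx; rewrite leNgt; apply/negP => x2pi.
have := sin_gt0_pi (_ : x / 2 \in `]0, pi[); rewrite in_itv/= => /(_ _).
have h : (0 < x / 2) && (x / 2 < pi) by apply/andP; split; lra.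
move=> /(_ h) s0.
have := cosD (x / 2) (x / 2); rewrite -splitr cx.
have := cos2Dsin2 (x / 2); nra.
Qed.

(** D^2 acts on w as -x^2, and odd powers of D contribute nothing because w^T D w = 0 for skew D;
    what remains is the cosine series. This avoids complex eigenvectors of D. *)
Lemma expm_quadratic_form D (w : 'cV[R]_n) (x : R) : D^T = - D ->
  (D^T *m D) *m w = x ^+ 2 *: w ->
  (w^T *m expm D *m w) 0 0 = cos x * (w^T *m w) 0 0.
Proof.
move=> Dskew Dw.
have DDw : D *m (D *m w) = - x ^+ 2 *: w.
  by rewrite scaleNr -Dw Dskew !mulNmx opprK mulmxA.
have Deven k : D ^+ k.*2 *m w = ((-1) ^+ k * x ^+ k.*2) *: w.
  elim: k => [|k IH]; first by rewrite !expr0 mul1r scale1r mul1mx.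
  rewrite doubleS !exprSr -!mulmxE -!mulmxA DDw -scalemxAr IH scalerA.
  by congr (_ *: _); ring.
have wDw : (w^T *m D *m w) 0 0 = 0.
  have : (w^T *m D *m w) 0 0 = - (w^T *m D *m w) 0 0.
    rewrite -[in LHS](trmxK (w^T *m D *m w)) mxE !trmx_mul trmxK Dskew.
    by rewrite mulNmx mulmxN mxE mulmxA.
  by lra.
have term k : (w^T *m ((k`!%:R)^-1 *: D ^+ k) *m w) 0 0
    = (w^T *m w) 0 0 * cos_coeff x k.
  rewrite -scalemxAr -scalemxAl mxE /cos_coeff /=.
  rewrite -[k in D ^+ k]odd_double_half -[k in x ^+ k]odd_double_half.
  case: (odd k) => /=; rewrite ?add0n ?add1n.
    rewrite exprS -mulmxE -mulmxA -mulmxA Deven -!scalemxAr mulmxA mxE wDw.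
    by rewrite !mulr0 !mul0r mulr0.
  by rewrite -exprnP -mulmxA Deven -scalemxAr mxE; ring.
(* The quadratic form is a continuous linear function of the matrix, so it passes through the limit
   of the series. *)
have lin : linear (fun M : 'M[R]_n => (w^T *m M *m w) 0 0 : R).
  by move=> a U V; rewrite mulmxDr mulmxDl -scalemxAr -scalemxAl !mxE.
pose F := GRing.isLinear.Build _ _ _ _ _ lin.
pose f : {linear 'M[R]_n -> R} :=
  HB.pack (fun M : 'M[R]_n => (w^T *m M *m w) 0 0 : R) F.
have fc : continuous f.
  apply: bounded_linear_continuous; apply/linear_boundedP; near=> r => M.
  apply: le_trans (norm_mx_coord _ _ _) _; apply: le_trans (norm_mulmx _ _) _.
  apply: (@le_trans _ _ (n%:R * (n%:R * `|w^T| * `|M|) * `|w|)).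
    by rewrite ler_wpM2r// ler_wpM2l// norm_mulmx.
  rewrite (_ : _ * `|w| = (n%:R * (n%:R * `|w^T|) * `|w|) * `|M|); last by ring.
  by apply: ler_wpM2r => //; near: r; apply: nbhs_pinfty_ge; rewrite num_real.
have := cvg_series_linear fc (expm_cvg D).
have -> : f \o (fun k => (k`!%:R)^-1 *: D ^+ k) = (w^T *m w) 0 0 *: cos_coeff x.
  by apply/funext => k; exact: term.
rewrite -[LHS]/(f (expm D)) => /cvg_lim <-//.
rewrite lim_seriesZ; last exact: is_cvg_series_cos_coeff.
by rewrite unlock mulrC.
Unshelve. all: by end_near. Qed.

(** From |D w|^2 = c |w|^2 one gets c > 0; then the quadratic form at x = sqrt c gives cos x = 1, so
    x >= 2 pi. *)
Lemma eigenvalue_expm_eq1 D (w : 'cV[R]_n) c : D^T = - D -> expm D = 1 ->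
  (D^T *m D) *m w = c *: w -> D *m w != 0 -> (2 * pi) ^+ 2 <= c.
Proof.
move=> Dskew eD Dw Dw0.
have w0 : 0 < frobnorm w.
  rewrite lt_neqAle frobnorm_ge0 andbT eq_sym.
  by apply: contraNneq Dw0 => /frobnorm_eq0 ->; rewrite mulmx0.
have DDw0 : 0 < frobnorm (D *m w).
  rewrite lt_neqAle frobnorm_ge0 andbT eq_sym.
  by apply: contraNneq Dw0 => /frobnorm_eq0 ->.
have ww : (w^T *m w) 0 0 = frobnorm w ^+ 2.
  by rewrite sqr_frobnorm /mxtrace big_ord1.
have cE : frobnorm (D *m w) ^+ 2 = c * frobnorm w ^+ 2.
  rewrite !sqr_frobnorm trmx_mul -mulmxA [D^T *m _]mulmxA Dw -scalemxAr.
  by rewrite mxtraceZ.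
have c0 : 0 < c.
  by rewrite -(pmulr_lgt0 _ (exprn_gt0 2 w0)) -cE exprn_gt0.
have cs : c = Num.sqrt c ^+ 2 by rewrite sqr_sqrtr// ltW.
rewrite cs in Dw; have := expm_quadratic_form Dskew Dw.
rewrite eD mulmx1 ww => /eqP; rewrite -subr_eq0 -{1}[_ ^+ 2]mul1r -mulrBl.
rewrite mulf_eq0 expf_eq0/= (gt_eqF w0) orbF subr_eq0 => /eqP/esym cos1.
rewrite [leRHS]cs.
apply: lerXn2r; rewrite ?nnegrE ?sqrtr_ge0 ?mulr_ge0 ?pi_ge0//.
by apply: cos_eq1_ge => //; rewrite sqrtr_gt0.
Qed.

(** Both squared norms are split along an eigenframe of D^T D: the terms agree where D w = 0 and
    differ strictly elsewhere. *)
Lemma frobnorm_lt_of_expm_eq1 D E : D^T = - D -> expm D = 1 -> D != 0 ->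
  specnorm E < pi -> frobnorm E < frobnorm (D + E).
Proof.
move=> Dskew eD D0 Epi.
have DDsym : (D^T *m D)^T = D^T *m D by rewrite trmx_mul trmxK.
have [I [w [c [Dw w1]]]] := symmetric_eigenframe DDsym.
have lt_i i : D *m w i != 0 ->
    frobnorm (E *m w i) ^+ 2 < frobnorm ((D + E) *m w i) ^+ 2.
  move=> Dwi0; have cge := eigenvalue_expm_eq1 Dskew eD (Dw i) Dwi0.
  have wi0 : 0 < frobnorm (w i).
    rewrite lt_neqAle frobnorm_ge0 andbT eq_sym.
    by apply: contraNneq Dwi0 => /frobnorm_eq0 ->; rewrite mulmx0.
  have cE : frobnorm (D *m w i) ^+ 2 = c i * frobnorm (w i) ^+ 2.
    rewrite !sqr_frobnorm trmx_mul -mulmxA [D^T *m _]mulmxA Dw -scalemxAr.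
    by rewrite mxtraceZ.
  have Elt : frobnorm (E *m w i) ^+ 2 < pi ^+ 2 * frobnorm (w i) ^+ 2.
    rewrite -exprMn; apply: ltrXn2r; rewrite ?nnegrE ?frobnorm_ge0//.
    by apply: le_lt_trans (frobnorm_mul_le _ _) _; rewrite ltr_pM2r.
  (* Half of (2 pi)^2 is twice pi^2: this is where the radius pi enters. *)
  have := sqr_frobnormD_ge (D *m w i) (E *m w i); rewrite -mulmxDl cE.
  have := ler_wpM2r (sqr_ge0 (frobnorm (w i))) cge.
  by rewrite exprMn; lra.
have le_i i : frobnorm (E *m w i) ^+ 2 <= frobnorm ((D + E) *m w i) ^+ 2.
  have [Dwi0|/lt_i/ltW//] := eqVneq (D *m w i) 0.
  by rewrite mulmxDl Dwi0 add0r.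
rewrite -(ltr_pXn2r (n := 2)) ?nnegrE ?frobnorm_ge0//.
rewrite (sqr_frobnorm_frame E w1) (sqr_frobnorm_frame (D + E) w1).
(* The frame resolves the identity, so a nonzero D cannot annihilate all its vectors. *)
have [i Dwi] : exists i, D *m w i != 0.
  apply/existsP; apply: contraNT D0 => /existsPn Dw0.
  apply/eqP; rewrite -[D]mulmx1 -w1 mulmx_sumr big1// => i _.
  by have := Dw0 i; rewrite negbK mulmxA => /eqP ->; rewrite mul0mx.
by rewrite (bigD1 i)//= [ltRHS](bigD1 i)//= ltr_leD ?lt_i// ler_sum.
Qed.

(** The commutator formula with both matrices equal, where the direction is 0. *)
Lemma expm_comm Y : Y * expm Y = expm Y * Y.
Proof. by apply/subr0_eq; rewrite -dexpm_commutator subrr linear0. Qed.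

(* Geometrically, Y L - L Y is tangent to the orbit of L under conjugation by
   the one-parameter group of Y, and this orbit lies in a fibre of expm. *)
Lemma skew_log_comm L Y : Skew L -> ~ rank_deficient L -> Skew Y ->
  expm Y = expm L -> Y * L = L * Y.
Proof.
move=> Lskew Lreg Yskew eYL; apply/eqP; rewrite -subr_eq0; apply/eqP.
set H := Y * L - L * Y.
have Hskew : H \in skewv R n.
  apply/skewvP; rewrite /Skew /= /H raddfB/= -!mulmxE !trmx_mul.
  by rewrite Lskew Yskew !mulNmx !mulmxN !opprK opprB.
have dH : dexpm L H = 0 by rewrite dexpm_commutator -eYL expm_comm subrr.
set f := linfun ('d (@expm R n) L).
have Hker : H \in lker f by rewrite memv_ker lfunE /= diff_expm dH.
(* Rank-nullity: without loss of rank, the differential is injective on the skew matrices. *)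
have : \dim (skewv R n :&: lker f) == 0%N.
  have := limg_ker_dim f (skewv R n).
  have : (\dim (skewv R n) <= \dim (f @: skewv R n))%N.
    by rewrite leqNgt; apply/negP => h; apply: Lreg.
  by move=> h1 h2; rewrite -leqn0 -(leq_add2r (\dim (f @: skewv R n))) h2.
rewrite dimv_eq0 => /eqP K0; have : H \in (skewv R n :&: lker f)%VS.
  by rewrite memv_cap Hskew.
by rewrite K0 memv0 => /eqP.
Qed.

(** As Y and L commute, Q [expm (Y - L)] = Q, and orthogonality cancels Q. The previous estimate
    then applies to D = Y - L and E = L - S, with D + E = Y - S. *)
Lemma frobnorm_lt_skew_log (S L Y Q : 'M[R]_n) : SO Q ->
  expm_preim Q L -> ~ rank_deficient L -> specnorm (L - S) < pi ->
  expm_preim Q Y -> Y != L -> frobnorm (L - S) < frobnorm (Y - S).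
Proof.
move=> [QQ _] [Lskew eL] Lreg LS [Yskew eY] YL.
have YLC : Y * L = L * Y by apply: skew_log_comm => //; rewrite eY.
have eD : expm (Y - L) = 1.
  have : expm L * expm (Y - L) = expm Y.
    by rewrite -expmD ?mulrBl ?mulrBr ?YLC// addrC subrK.
  rewrite eL eY -mulmxE => /(congr1 (mulmx Q^T)).
  by rewrite mulmxA QQ mul1mx.
rewrite -(subrK L Y) -addrA; apply: frobnorm_lt_of_expm_eq1 => //.
  by rewrite raddfB/= Lskew Yskew opprB opprK addrC.
by rewrite subr_eq0.
Qed.

End SkewExponential.

Theorem corollary5p8 (R : realType) (n : nat)
    (Ce : set 'M[R]_n) (S Q : 'M[R]_n) (hCe : Dcomponent Ce) (hS : Ce S)
    (hQ : SO Q)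
    (hnlog : (Ce `&` [set X | specnorm (X - S) < pi] `&` expm_preim Q)
               (nlog S Q)) :
  argmin (expm_preim Q) (fun X => frobnorm (X - S)) = [set nlog S Q].
Proof.
case: hnlog => -[CL /= LS] QL; set L := nlog S Q in CL LS QL *.
have Lreg : ~ rank_deficient L by case: hCe => /(_ _ CL) [].
(* Strictness yields both minimality and uniqueness. *)
have closest Y : expm_preim Q Y -> Y != L ->
    frobnorm (L - S) < frobnorm (Y - S).
  exact: frobnorm_lt_skew_log hQ QL Lreg LS.
apply/seteqP; split=> [Y [QY Ymin]|_ ->] /=.
  apply/eqP/negP => /negP YL; have := closest _ QY YL.
  by rewrite ltNge Ymin.
split=> // Y QY; have [->//|YL] := eqVneq Y L.
exact/ltW/closest.
Qed.
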